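(* Let $L,m,n$ be positive integers with $m<L$. Let $A=[a(\theta_1),\dots,a(\theta_m)]\in\mathbb{C}^{L\times m}$ have linearly independent columns, let $D=[d_1,\dots,d_m]\in\mathbb{C}^{L\times m}$ with $d_i=\frac{d\,a(\theta_i)}{d\theta_i}$, and let $C\in\mathbb{C}^{L\times L}$ be Hermitian positive definite (noise spatial covariance). Let $\mathcal{P}_{n+1}\in\mathbb{C}^{(n+1)m\times(n+1)m}$ be the Hermitian positive definite space-time covariance matrix of the signal snapshots $s(t_1),\dots,s(t_{n+1})\in\mathbb{C}^m$, and let $\mathcal{P}_n\in\mathbb{C}^{nm\times nm}$ be its leading principal $nm\times nm$ submatrix, i.e. the space-time covariance matrix of $s(t_1),\dots,s(t_n)$. For $k\in\{n,n+1\}$ let $\mathrm{CRB}^{\mathrm{cor}}(k)$ be the $m\times m$ Cramér–Rao bound matrix for $\boldsymbol\theta=(\theta_1,\dots,\theta_m)$ in the temporally correlated signal model with $k$ snapshots and signal covariance $\mathcal{P}_k$, as given by the formula in the context (the inverses defining it being assumed to exist). Then $$\mathrm{CRB}^{\mathrm{cor}}(n+1)<\mathrm{CRB}^{\mathrm{cor}}(n),$$ where $X<Y$ means that $Y-X$ is positive definite.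
   Context: Setting: an array of $L$ sensors observes $k$ snapshots $x(t_j)=A s(t_j)+\nu(t_j)$, $j=1,\dots,k$, where $a(\theta)\in\mathbb{C}^L$ is a smooth steering vector, any set of $L$ steering vectors at distinct angles is linearly independent, and $\theta_1,\dots,\theta_m$ are distinct. The noise is zero-mean Gaussian, temporally uncorrelated, with spatial covariance $C$. The signals are zero-mean Gaussian with space-time covariance $\mathcal{P}_k$, whose $m\times m$ blocks are $\mathcal{P}^{ij}=\mathrm{E}[s(t_i)s^{\mathrm{H}}(t_j)]$, so the stacked data vector has covariance $\mathcal{R}_k=\mathcal{A}_k\mathcal{P}_k\mathcal{A}_k^{\mathrm{H}}+\mathcal{C}_k$ with $\mathcal{A}_k=I_k\otimes A$ and $\mathcal{C}_k=I_k\otimes C$. Notation: $(\cdot)^{\mathrm{H}}$ is conjugate transpose, $(\cdot)^{\mathrm{T}}$ transpose, $\odot$ the entrywise (Hadamard) product, $\otimes$ the Kronecker product, $\Re$ the entrywise real part, $C^{-1/2}$ the Hermitian positive definite square root of $C^{-1}$. For a $km\times km$ matrix $\mathcal{M}$ partitioned into $m\times m$ blocks $\mathcal{M}^{ij}$, the block trace is $\mathrm{BTr}_m(\mathcal{M})=\sum_{i=1}^k\mathcal{M}^{ii}$. Put $$\Pi_0^{\perp}=I-G(G^{\mathrm{H}}G)^{-1}G^{\mathrm{H}},\qquad G=C^{-1/2}A,\qquad H=\Re\big(D^{\mathrm{H}}C^{-1/2}\Pi_0^{\perp}C^{-1/2}D\big).$$ The Cramér–Rao bound matrix is $$\mathrm{CRB}^{\mathrm{cor}}(k)=\frac{1}{2}\big[H\odot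 \mathrm{BTr}_m(\mathcal{P}_k\mathcal{A}_k^{\mathrm{H}}\mathcal{R}_k^{-1}\mathcal{A}_k\mathcal{P}_k)^{\mathrm{T}}\big]^{-1}.$$ *)

(* Defs.v *)
From HB Require Import structures.
From mathcomp Require Import all_boot all_order all_algebra.
From mathcomp Require Import all_classical all_reals all_analysis.
From mathcomp Require Import complex mxtens.

Set Implicit Arguments.
Unset Strict Implicit.
Unset Printing Implicit Defensive.

Import Order.TTheory GRing.Theory Num.Theory.
Import numFieldNormedType.Exports.

Local Open Scope classical_set_scope.
Local Open Scope ring_scope.
Local Open Scope sesquilinear_scope.

Section ComplexMatrices.
Variable K : numClosedFieldType.

(* In the order of [K], [0 < z] forces [z] to be real. *)
Definition posdefmx n (M : 'M[K]_n) : Prop :=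
  M \is hermsymmx /\
  forall v : 'cV[K]_n, v != 0 -> 0 < (v ^t* *m M *m v) 0 0.

Definition posdef_lt n (X Y : 'M[K]_n) : Prop := posdefmx (Y - X).

(* [M^(-1/2)]: the positive definite Hermitian square root of the inverse;
   [invsqrtmxP] below shows that the default value [0] is never used when [M]
   is positive definite. *)
Definition invsqrtmx n (M : 'M[K]_n) : 'M[K]_n :=
  xget 0 [set W : 'M[K]_n | posdefmx W /\ W *m W = invmx M].

Definition hadamardmx m n (X Y : 'M[K]_(m, n)) : 'M[K]_(m, n) :=
  map2_mx *%R X Y.

(* The [(t, u)] block of size [m x m]; [mxtens_index (t, i)] is the index
   [t * m + i], the convention under which [X *t Y] is the Kronecker product. *)
Definition mxblk k m (M : 'M[K]_(k * m)) (t u : 'I_k) : 'M[K]_m :=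
  mxsub (fun i => mxtens_index (t, i)) (fun j => mxtens_index (u, j)) M.

Definition btr k m (M : 'M[K]_(k * m)) : 'M[K]_m := \sum_(t < k) mxblk M t t.

Definition leadmx n m (M : 'M[K]_(n.+1 * m)) : 'M[K]_(n * m) :=
  let w := widen_ord (leq_addl m (n * m) : (n * m <= n.+1 * m)%N) in
  mxsub w w M.

Section Bound.
Variables L m : nat.
Implicit Types (A D : 'M[K]_(L, m)) (C : 'M[K]_L).

Definition proj_orth A C : 'M[K]_L :=
  let G := invsqrtmx C *m A in
  1%:M - G *m invmx (G ^t* *m G) *m (G ^t*).

Definition Hmx A D C : 'M[K]_m :=
  map_mx (fun z => 'Re z)
    ((D ^t*) *m invsqrtmx C *m proj_orth A C *m invsqrtmx C *m D).

Definition data_cov k A C (P : 'M[K]_(k * m)) : 'M[K]_(k * L) :=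
  let Ak := (1%:M : 'M[K]_k) *t A in
  Ak *m P *m Ak ^t* + (1%:M : 'M[K]_k) *t C.

(* [Hmx A D C] is real symmetric but the block trace is only Hermitian, so
   this matrix and [crb] may have non-real off-diagonal entries. *)
Definition fisher_core k A D C (P : 'M[K]_(k * m)) : 'M[K]_m :=
  let Ak := (1%:M : 'M[K]_k) *t A in
  hadamardmx (Hmx A D C)
    (btr (P *m Ak ^t* *m invmx (data_cov A C P) *m Ak *m P))^T.

Definition crb k A D C (P : 'M[K]_(k * m)) : 'M[K]_m :=
  2^-1 *: invmx (fisher_core A D C P).

End Bound.

Lemma posdef_diag n (U : 'M[K]_n) (e : 'rV[K]_n) : U \is unitarymx ->
  (forall i, 0 < e 0 i) -> posdefmx (U ^t* *m diag_mx e *m U).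
Proof.
move=> Uu e0; split.
  rewrite is_hermitianmxE expr0 scale1r !trmx_mul !map_mxM !map_trmx trmxK.
  rewrite -map_mx_comp (map_mx_id (@conjCK _)) tr_diag_mx map_diag_mx mulmxA.
  rewrite (_ : map_mx _ e = e) //; apply/rowP => i; rewrite mxE.
  by apply/CrealP/gtr0_real.
move=> v v0; set w := U *m v.
have w0 : w != 0.
  apply: contraNneq v0 => w0.
  by rewrite -(mulKmx (unitarymx_unit Uu) v) -/w w0 mulmx0.
have -> : v ^t* *m (U ^t* *m diag_mx e *m U) *m v = w ^t* *m diag_mx e *m w.
  by rewrite /w trmx_mul map_mxM !mulmxA.
rewrite mxE.
have E i : (w ^t* *m diag_mx e) 0 i * w i 0 = e 0 i * `|w i 0| ^+ 2.
  by rewrite mul_mx_diag !mxE normCK mulrAC [LHS]mulrC [X in _ * X = _]mulrC.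
under eq_bigr do rewrite E.
have [i wi] : exists i, w i 0 != 0.
  apply/existsP; apply: contraNT w0 => /existsPn h; apply/eqP/colP => i.
  by rewrite [RHS]mxE; apply/eqP; have := h i; rewrite negbK.
rewrite (bigD1 i) //=; apply: ltr_pwDl.
  by rewrite mulr_gt0 ?exprn_gt0 ?normr_gt0.
by apply: sumr_ge0 => j _; rewrite mulr_ge0 ?exprn_ge0 // ltW.
Qed.

Lemma invsqrtmxP n (M : 'M[K]_n) : posdefmx M ->
  posdefmx (invsqrtmx M) /\ invsqrtmx M *m invsqrtmx M = invmx M.
Proof.
move=> [Mh Mp]; rewrite /invsqrtmx; set S := [set W | _].
suff /(xgetPex 0) : exists W, S W by [].
have /orthomx_spectralP := hermitian_normalmx Mh.
set U := spectralmx M; set d := spectral_diag M => ME.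
have Uu : U \is unitarymx by exact: spectral_unitarymx.
have UV : U *m U ^t* = 1%:M by apply/unitarymxP.
rewrite invmx_unitary // in ME.
have d0 i : 0 < d 0 i.
  pose v : 'cV[K]_n := U ^t* *m delta_mx i 0.
  have Uv : U *m v = delta_mx i 0 by rewrite mulmxA UV mul1mx.
  have v0 : v != 0.
    apply/eqP => v0; move: Uv; rewrite v0 mulmx0 => /matrixP/(_ i 0)/eqP.
    by rewrite !mxE !eqxx /= eq_sym oner_eq0.
  have vU : v ^t* *m U ^t* = delta_mx 0 i.
    by rewrite -map_mxM -trmx_mul Uv trmx_delta map_delta_mx.
  have -> : d 0 i = (v ^t* *m M *m v) 0 0; last exact: Mp.
  have -> : v ^t* *m M *m v = (v ^t* *m U ^t*) *m diag_mx d *m (U *m v).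
    by rewrite {1}ME -!mulmxA.
  by rewrite vU Uv -rowE -colE !mxE eqxx mulr1n.
exists (U ^t* *m diag_mx (\row_i (sqrtC (d 0 i))^-1) *m U); split.
  by apply: posdef_diag => // i; rewrite mxE invr_gt0 sqrtC_gt0.
have UV' := mulmx1C UV.
set e := diag_mx _.
have -> : U ^t* *m e *m U *m (U ^t* *m e *m U) = U ^t* *m (e *m e) *m U.
  by rewrite !mulmxA -(mulmxA _ U) UV mulmx1.
have MW : M *m (U ^t* *m (e *m e) *m U) = 1%:M.
  rewrite ME !mulmxA -(mulmxA _ U) UV mulmx1 -!mulmxA (mulmxA e) mulmxA.
  rewrite -[RHS]UV' mulmxA; congr (_ *m _); rewrite -mulmxA -[RHS]mulmx1.
  congr (_ *m _); rewrite !mulmx_diag -diag_const_mx; congr diag_mx.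
  apply/rowP => i; rewrite !mxE -invfM -expr2 sqrtCK divff //.
  by rewrite gt_eqF.
have Mu : M \in unitmx by case/mulmx1_unit: MW.
by rewrite -[LHS](mulKmx Mu) MW mulmx1.
Qed.

End ComplexMatrices.

Section Steering.
Variables (R : realType) (L m : nat).
Implicit Types (a : R -> 'cV[R[i]]_L) (th : 'I_m -> R).

Definition re_coord a (l : 'I_L) : R -> R := fun t => complex.Re (a t l 0).
Definition im_coord a (l : 'I_L) : R -> R := fun t => complex.Im (a t l 0).

Definition smooth_on (T : set R) a : Prop :=
  forall (l : 'I_L) (n : nat) (t : R), T t ->
    derivable (derive1n n (re_coord a l)) t 1 /\
    derivable (derive1n n (im_coord a l)) t 1.

Definition steering_mx a th : 'M[R[i]]_(L, m) :=
  \matrix_(l, i) a (th i) l 0.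

Definition dsteering_mx a th : 'M[R[i]]_(L, m) :=
  \matrix_(l, i) (derive1 (re_coord a l) (th i)
                  +i* derive1 (im_coord a l) (th i))%C.

End Steering.

(* Main.v *)
Require Import Defs.
From HB Require Import structures.
From mathcomp Require Import all_boot all_order all_algebra.
From mathcomp Require Import all_classical all_reals all_analysis.
From mathcomp Require Import complex mxtens.

(* Let [W_k] be the covariance of the linear MMSE estimate of the [k] signal
   snapshots, so that the Fisher matrix is [F_k = H o (BTr W_k)^T].  An extra
   snapshot can only increase the covariance of the estimates of the first [n]
   signals, because [R^-1 >= E (E^H R E)^-1 E^H] for the inclusion [E] of the
   first [n] snapshots; the last diagonal block of [W_(n+1)] then contributes a
   positive definite term, so [BTr W_n < BTr W_(n+1)].  Now [H] is half a Gram
   matrix [S^H S], and invertibility of [F_(n+1)] prevents [S] from having a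
   zero column, so the Hadamard product with [H] preserves strict positivity
   (Schur), and inversion reverses [F_n < F_(n+1)]. *)

Set Implicit Arguments.
Unset Strict Implicit.
Unset Printing Implicit Defensive.

Import Order.TTheory GRing.Theory Num.Theory.
Import numFieldNormedType.Exports.

Local Open Scope classical_set_scope.
Local Open Scope ring_scope.
Local Open Scope sesquilinear_scope.

(** * Conjugate transposes, semidefinite and definite matrices, and their congruences *)

Section PositiveDefinite.
Variable K : numClosedFieldType.

Lemma trmxC_mul m n p (A : 'M[K]_(m, n)) (B : 'M[K]_(n, p)) :
  (A *m B) ^t* = B ^t* *m A ^t*.
Proof. by rewrite trmx_mul map_mxM. Qed.

Lemma trmxCD m n (A B : 'M[K]_(m, n)) : (A + B) ^t* = A ^t* + B ^t*.
Proof. by rewrite linearD map_mxD. Qed.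

Lemma trmxCB m n (A B : 'M[K]_(m, n)) : (A - B) ^t* = A ^t* - B ^t*.
Proof. by rewrite linearB map_mxB. Qed.

Lemma trmxC1 n : (1%:M : 'M[K]_n) ^t* = 1%:M.
Proof. by rewrite trmx1 map_mx1. Qed.

Lemma trmxC_inv n (A : 'M[K]_n) : (invmx A) ^t* = invmx (A ^t*).
Proof. by rewrite trmx_inv map_invmx. Qed.

Lemma trmxC_tens m n p q (A : 'M[K]_(m, n)) (B : 'M[K]_(p, q)) :
  (A *t B) ^t* = A ^t* *t B ^t*.
Proof. by rewrite trmx_tens map_mxT. Qed.

Lemma hermsymmxP n (M : 'M[K]_n) : reflect (M ^t* = M) (M \is hermsymmx).
Proof.
rewrite is_hermitianmxE expr0 scale1r.
by apply: (iffP eqP).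
Qed.

Definition psdmx n (M : 'M[K]_n) : Prop :=
  M \is hermsymmx /\ forall v : 'cV[K]_n, 0 <= (v ^t* *m M *m v) 0 0.

Lemma posdef_psd n (M : 'M[K]_n) : posdefmx M -> psdmx M.
Proof.
move=> [Mh Mp]; split=> // v; have [->|v0] := eqVneq v 0; last exact/ltW/Mp.
by rewrite mulmx0 mxE.
Qed.

Lemma psd0 n : psdmx (0 : 'M[K]_n).
Proof.
split; first by apply/hermsymmxP; rewrite trmx0 map_mx0.
by move=> v; rewrite mulmx0 mul0mx mxE.
Qed.

Lemma psdD n (M N : 'M[K]_n) : psdmx M -> psdmx N -> psdmx (M + N).
Proof.
move=> [/hermsymmxP Mh Mp] [/hermsymmxP Nh Np]; split.
  by apply/hermsymmxP; rewrite trmxCD Mh Nh.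
by move=> v; rewrite mulmxDr mulmxDl mxE addr_ge0.
Qed.

Lemma psd_sum n (I : finType) (Q : pred I) (M : I -> 'M[K]_n) :
  (forall i, psdmx (M i)) -> psdmx (\sum_(i | Q i) M i).
Proof. by move=> Mp; elim/big_ind: _ => //; [exact: psd0 | exact: psdD]. Qed.

Lemma posdefDr n (M N : 'M[K]_n) : psdmx M -> posdefmx N -> posdefmx (M + N).
Proof.
move=> [/hermsymmxP Mh Mp] [/hermsymmxP Nh Np]; split.
  by apply/hermsymmxP; rewrite trmxCD Mh Nh.
by move=> v v0; rewrite mulmxDr mulmxDl mxE ltr_wpDl ?Np.
Qed.

Lemma psd_congr m n (X : 'M[K]_(m, n)) (M : 'M[K]_m) :
  psdmx M -> psdmx (X ^t* *m M *m X).
Proof.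
move=> [/hermsymmxP Mh Mp]; split.
  by apply/hermsymmxP; rewrite !trmxC_mul Mh trmxCK mulmxA.
move=> v; have -> : v ^t* *m (X ^t* *m M *m X) *m v =
    (X *m v) ^t* *m M *m (X *m v) by rewrite trmxC_mul !mulmxA.
exact: Mp.
Qed.

(** The left inverse [Y] makes [X] injective, so [X *m v] stays nonzero. *)
Lemma posdef_congr m n (X : 'M[K]_(m, n)) (Y : 'M[K]_(n, m)) (M : 'M[K]_m) :
  Y *m X = 1%:M -> posdefmx M -> posdefmx (X ^t* *m M *m X).
Proof.
move=> YX Mpd; have [Xh _] := psd_congr X (posdef_psd Mpd); split=> // v v0.
have -> : v ^t* *m (X ^t* *m M *m X) *m v =
    (X *m v) ^t* *m M *m (X *m v) by rewrite trmxC_mul !mulmxA.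
apply: (proj2 Mpd); apply: contraNneq v0 => Xv.
by rewrite -[v]mul1mx -YX -mulmxA Xv mulmx0.
Qed.

Lemma posdef1 n : posdefmx (1%:M : 'M[K]_n).
Proof.
have := @posdef_diag K n 1%:M (const_mx 1).
rewrite trmxC1 mul1mx mulmx1 diag_const_mx; apply=> [|i].
  by apply/unitarymxP; rewrite trmxC1 mulmx1.
by rewrite mxE.
Qed.

Lemma posdef_unit n (M : 'M[K]_n) : posdefmx M -> M \in unitmx.
Proof.
move=> [/hermsymmxP Mh Mp]; rewrite -row_free_unit -kermx_eq0.
apply: contraT => /rowV0Pn[u /sub_kermxP uM u0].
(* A nonzero row [u] in the left kernel makes the quadratic form vanish at [u ^t*]. *)
have v0 : u ^t* != 0.
  by apply: contraNneq u0 => u0; rewrite -[u]trmxCK u0 trmx0 map_mx0.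
by have := Mp _ v0; rewrite trmxCK uM mul0mx mxE ltxx.
Qed.

Lemma posdef_inv n (M : 'M[K]_n) : posdefmx M -> posdefmx (invmx M).
Proof.
move=> Mpd; have Mu := posdef_unit Mpd; have [/hermsymmxP Mh _] := Mpd.
have -> : invmx M = (invmx M) ^t* *m M *m invmx M.
  by rewrite trmxC_inv Mh mulVmx // mul1mx.
exact: (posdef_congr (mulmxV Mu)).
Qed.

Lemma posdef_scale n (c : K) (M : 'M[K]_n) :
  0 < c -> posdefmx M -> posdefmx (c *: M).
Proof.
move=> c0 [/hermsymmxP Mh Mp]; split=> [|v v0].
  apply/hermsymmxP; rewrite linearZ map_mxZ /= Mh.
  by congr (_ *: _); apply/CrealP/gtr0_real.
by rewrite -scalemxAr -scalemxAl mxE mulr_gt0 ?Mp.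
Qed.

(** A 1 x 1 matrix is its own transpose, so the form of [M^T] at [v] is the form of [M] at the
    conjugate of [v]. *)
Lemma posdef_tr n (M : 'M[K]_n) : posdefmx M -> posdefmx M^T.
Proof.
move=> [/hermsymmxP Mh Mp]; split=> [|v v0].
  by apply/hermsymmxP; rewrite -[in RHS]Mh map_trmx.
have -> : (v ^t* *m M^T *m v) 0 0 =
    ((map_mx Num.conj v) ^t* *m M *m map_mx Num.conj v) 0 0.
  rewrite -[v ^t* *m _ *m v]trmxK [LHS]mxE !trmx_mul trmxK !map_trmx trmxK.
  by rewrite -map_mx_comp (map_mx_id (@conjCK K)) mulmxA.
apply: Mp; apply: contraNneq v0 => cv0.
by rewrite -[v](map_mx_id (@conjCK K)) map_mx_comp cv0 map_mx0.
Qed.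

(** * Principal submatrices, Kronecker products and block traces *)

Lemma colsub1_ct m n (f : 'I_m -> 'I_n) :
  (colsub f 1%:M : 'M[K]_(n, m)) ^t* = rowsub f 1%:M.
Proof. by apply/matrixP => i j; rewrite !mxE eq_sym rmorph_nat. Qed.

Lemma colsub1_isometry m n (f : 'I_m -> 'I_n) : injective f ->
  (colsub f 1%:M : 'M[K]_(n, m)) ^t* *m colsub f 1%:M = 1%:M.
Proof.
move=> f_inj; rewrite colsub1_ct -mxsub_mul mulmx1; apply/matrixP => i j.
by rewrite !mxE (inj_eq f_inj).
Qed.

(** With the selection matrix [colsub f 1%:M], taking a principal submatrix is a congruence and so
    inherits positivity. *)
Lemma mxsub_congrE m n (f : 'I_m -> 'I_n) (M : 'M[K]_n) :
  mxsub f f M = (colsub f 1%:M) ^t* *m M *m colsub f 1%:M.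
Proof. by rewrite colsub1_ct -rowsubE mulmx_colsub mulmx1 -mxsub_comp. Qed.

Lemma psd_mxsub m n (f : 'I_m -> 'I_n) (M : 'M[K]_n) :
  psdmx M -> psdmx (mxsub f f M).
Proof. by rewrite mxsub_congrE; apply: psd_congr. Qed.

Lemma posdef_mxsub m n (f : 'I_m -> 'I_n) (M : 'M[K]_n) :
  injective f -> posdefmx M -> posdefmx (mxsub f f M).
Proof.
move=> f_inj; rewrite mxsub_congrE; apply: posdef_congr.
exact: colsub1_isometry.
Qed.

Lemma tensmx11 k n :
  (1%:M : 'M[K]_k) *t (1%:M : 'M[K]_n) = 1%:M.
Proof.
apply/matrixP => i j; case: (mxtens_indexP i) => i0 i1.
case: (mxtens_indexP j) => j0 j1; rewrite tensmxE !mxE -natrM mulnb.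
by rewrite (can_eq (@mxtens_indexK _ _)).
Qed.

Lemma posdef_tens1 k n (M : 'M[K]_n) :
  posdefmx M -> posdefmx ((1%:M : 'M[K]_k) *t M).
Proof.
(* Applied to [invmx M], [invsqrtmx] yields a square root [W] of [M] itself, and [1 *t M] becomes
   the Gram matrix of the invertible [1 *t W]. *)
move=> Mpd; have [Wpd WW] := invsqrtmxP (posdef_inv Mpd).
have Wu := posdef_unit Wpd; have [/hermsymmxP Wh _] := Wpd.
set W := invsqrtmx _ in Wpd WW Wu Wh; rewrite invmxK in WW.
have -> : (1%:M : 'M[K]_k) *t M =
    (1%:M *t W) ^t* *m 1%:M *m ((1%:M : 'M[K]_k) *t W).
  by rewrite mulmx1 trmxC_tens trmxC1 Wh tensmx_mul mulmx1 WW.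
apply: (posdef_congr (Y := 1%:M *t invmx W)); last exact: posdef1.
by rewrite tensmx_mul mulVmx // mulmx1 tensmx11.
Qed.

Lemma posdef_btr k m (M : 'M[K]_(k * m)) :
  posdefmx M -> (0 < k)%N -> posdefmx (btr M).
Proof.
case: k M => // k M Mpd _; rewrite /btr big_ord_recr.
have blk t : posdefmx (mxblk M t t).
  by apply: posdef_mxsub => // i j /(can_inj (@mxtens_indexK _ _)) [].
by apply: posdefDr => //; apply: psd_sum => t; apply: posdef_psd.
Qed.

(** * Inversion, compression and Schur products in the Loewner order *)

Lemma posdef_lt_inv n (F G : 'M[K]_n) :
  posdefmx F -> posdef_lt F G -> posdef_lt (invmx G) (invmx F).
Proof.
move=> Fpd FG; have Gpd : posdefmx G.
  by rewrite -[G](subrK F) addrC; apply: posdefDr => //; apply: posdef_psd.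
have [Fu Gu] := (posdef_unit Fpd, posdef_unit Gpd).
have [/hermsymmxP Gh _] := Gpd; have [/hermsymmxP FGh _] := FG.
rewrite /posdef_lt.
(* The bracket equals [G *m invmx F *m G - G]; it is the sum of a semidefinite term and the definite
   [G - F]. *)
have -> : invmx F - invmx G = (invmx G) ^t* *m
    ((G - F) ^t* *m invmx F *m (G - F) + (G - F)) *m invmx G.
  rewrite FGh trmxC_inv Gh.
  have -> : (G - F) *m invmx F *m (G - F) + (G - F) = G *m invmx F *m G - G.
    rewrite mulmxBl mulmxV // mulmxBl mul1mx mulmxBr mulmxKV //.
    by rewrite subrK.
  rewrite mulmxBr mulmxBl !mulmxA mulVmx // !mul1mx.
  by rewrite -mulmxA mulmxV // mulmx1.
apply: (posdef_congr (mulmxV Gu)); apply: posdefDr => //.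
by apply: psd_congr; apply/posdef_psd/posdef_inv.
Qed.

(* The difference [N] of the two sides satisfies [N *m R *m N = N]. *)
Lemma compressed_inv_le p q (E : 'M[K]_(p, q)) (R : 'M[K]_p) :
    posdefmx R -> posdefmx (E ^t* *m R *m E) ->
  psdmx (invmx R - E *m invmx (E ^t* *m R *m E) *m E ^t*).
Proof.
move=> Rpd Spd; set S := _ *m E in Spd *; set N := _ - _.
have [Ru Su] := (posdef_unit Rpd, posdef_unit Spd).
have [/hermsymmxP Rh _] := Rpd; have [/hermsymmxP Sh _] := Spd.
have Nh : N ^t* = N.
  by rewrite trmxCB !trmxC_mul trmxCK !trmxC_inv Rh Sh mulmxA.
(* [N *m R] is the identity minus the [R]-orthogonal projection onto the range of [E]. *)
have NRE : N *m R *m E = 0.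
  rewrite /N !mulmxBl mulVmx // mul1mx -!mulmxA (mulmxA _ R) -/S.
  by rewrite mulVmx // mulmx1 subrr.
have -> : N = N ^t* *m R *m N; last exact/psd_congr/posdef_psd.
rewrite Nh; apply/esym; rewrite (mulmxBr (N *m R) (invmx R)).
by rewrite !mulmxA NRE !mul0mx subr0 mulmxK.
Qed.

(** A Gram matrix is the sum of the rank-one matrices of the rows of [S], and a Hadamard product
    with a rank-one matrix is a diagonal congruence. *)
Lemma hadamard_gramE p n (S : 'M[K]_(p, n)) (Y : 'M[K]_n) :
  hadamardmx (S ^t* *m S) Y =
  \sum_k (diag_mx (row k S)) ^t* *m Y *m diag_mx (row k S).
Proof.
apply/matrixP => i j; rewrite mxE summxE mxE mulr_suml.
apply: eq_bigr => k _; rewrite tr_diag_mx map_diag_mx mul_diag_mx mul_mx_diag.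
by rewrite !mxE mulrAC.
Qed.

Lemma posdef_hadamard_gram p n (S : 'M[K]_(p, n)) (Y : 'M[K]_n) :
    (forall j, col j S != 0) -> posdefmx Y ->
  posdefmx (hadamardmx (S ^t* *m S) Y).
Proof.
move=> S0 Ypd; have Ypsd := posdef_psd Ypd; rewrite hadamard_gramE; split.
  by apply: (proj1 (psd_sum _ _)) => k; apply: psd_congr.
move=> v /cV0Pn[j vj]; have /cV0Pn[k Skj] := S0 j.
(* Row [k] has a nonzero entry where [v] does, so its summand is strictly positive at [v]; the
   others are nonnegative. *)
rewrite (bigD1 k) //= addrC mulmxDr mulmxDl mxE.
apply: ltr_wpDl; first by apply: (proj2 (psd_sum _ _)) => i; apply: psd_congr.
set T := diag_mx _.
have -> : v ^t* *m (T ^t* *m Y *m T) *m v = (T *m v) ^t* *m Y *m (T *m v).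
  by rewrite trmxC_mul !mulmxA.
apply: (proj2 Ypd); apply/cV0Pn; exists j; rewrite mul_diag_mx !mxE.
by rewrite mulf_neq0 //; move: Skj; rewrite mxE.
Qed.

End PositiveDefinite.

(** * Effect of one more snapshot on the covariance of the signal estimates *)

Section Snapshots.
Variables (K : numClosedFieldType) (L m : nat).
Implicit Types (A D : 'M[K]_(L, m)) (C : 'M[K]_L).

(* [J (x) I_q], where [J] embeds the first [n] coordinates. *)
Definition extmx n q : 'M[K]_(n.+1 * q, n * q) :=
  (\matrix_(i < n.+1, j < n) (i == j :> nat)%:R) *t 1%:M.

(** The Kronecker form interacts well with [1 *t A], the selection form with [leadmx]. They agree
    because widening keeps the value [t * q + i], hence changes only the type of the block index. *)
Lemma extmxE n q :
  extmx n q = colsub (widen_ord (leq_addl q (n * q))) 1%:M.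
Proof.
apply/matrixP => i j; case: (mxtens_indexP i) => i0 i1.
case: (mxtens_indexP j) => j0 j1; rewrite tensmxE !mxE -natrM mulnb.
have -> : widen_ord (leq_addl q (n * q)) (mxtens_index (j0, j1)) =
    mxtens_index (widen_ord (leqnSn n) j0, j1) :> 'I_(n.+1 * q).
  exact: val_inj.
congr ((_ : bool)%:R).
exact: (esym (can_eq (@mxtens_indexK n.+1 q) (i0, i1) (widen_ord _ j0, j1))).
Qed.

Lemma extmxK n q : extmx n q ^t* *m extmx n q = 1%:M.
Proof. by rewrite extmxE colsub1_isometry // => i j [] /val_inj. Qed.

Lemma leadmxE n q (M : 'M[K]_(n.+1 * q)) :
  leadmx M = extmx n q ^t* *m M *m extmx n q.
Proof. by rewrite extmxE -mxsub_congrE. Qed.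

(** Both sides are the Kronecker product of [J ^t*] with [A]. *)
Lemma tens1_extmx_ct n A :
  extmx n L ^t* *m ((1%:M : 'M[K]_n.+1) *t A) =
  (1%:M : 'M[K]_n) *t A *m extmx n m ^t*.
Proof. by rewrite !trmxC_tens !trmxC1 !tensmx_mul !mulmx1 !mul1mx. Qed.

Lemma data_cov_lead n A C (P : 'M[K]_(n.+1 * m)) :
  data_cov A C (leadmx P) =
  extmx n L ^t* *m data_cov A C P *m extmx n L.
Proof.
rewrite /data_cov mulmxDr mulmxDl; congr (_ + _); last first.
  (* Noise term: inserting [extmxK] on the left brings both sides to the product of [J ^t* *m J]
     with [C]. *)
  rewrite !trmxC_tens !trmxC1 !tensmx_mul !mulmx1 !mul1mx -[C in LHS]mulmx1.
  rewrite -[LHS]mulmx1 -extmxK.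
  by rewrite !trmxC_tens !trmxC1 !tensmx_mul !mulmx1 !mul1mx.
rewrite leadmxE !mulmxA tens1_extmx_ct -!mulmxA; do 3 congr (_ *m _).
by rewrite -[RHS]trmxCK trmxC_mul trmxCK tens1_extmx_ct trmxC_mul trmxCK.
Qed.

Lemma data_cov_posdef k A C (P : 'M[K]_(k * m)) :
  posdefmx C -> posdefmx P -> posdefmx (data_cov A C P).
Proof.
move=> Cpd Ppd; apply: posdefDr; last exact: posdef_tens1.
by rewrite -[X in X *m _ *m _]trmxCK; apply/psd_congr/posdef_psd.
Qed.

(** The matrix [W_k]: with [R] the data covariance, the linear MMSE estimate of the stacked signal
    from data [x] is [P Ak^H R^-1 x]. *)
Definition estimate_cov k A C (P : 'M[K]_(k * m)) : 'M[K]_(k * m) :=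
  let Ak := (1%:M : 'M[K]_k) *t A in
  P *m Ak ^t* *m invmx (data_cov A C P) *m Ak *m P.

Lemma estimate_covE k A C (P : 'M[K]_(k * m)) : posdefmx P ->
  estimate_cov A C P = ((1%:M : 'M[K]_k) *t A *m P) ^t* *m
    invmx (data_cov A C P) *m ((1%:M : 'M[K]_k) *t A *m P).
Proof.
by case=> /hermsymmxP Ph _; rewrite trmxC_mul Ph /estimate_cov !mulmxA.
Qed.

(** Full column rank of [A] gives [(1 *t A) *m P] a left inverse, so this is an injective congruence
    of the inverse data covariance. *)
Lemma estimate_cov_posdef k A C (P : 'M[K]_(k * m)) :
  row_free A^T -> posdefmx C -> posdefmx P -> posdefmx (estimate_cov A C P).
Proof.
move=> /row_freeP[B AB] Cpd Ppd; rewrite estimate_covE //.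
have BA : B^T *m A = 1%:M by rewrite -[A]trmxK -trmx_mul AB trmx1.
apply: (posdef_congr (Y := invmx P *m (1%:M *t B^T))).
  rewrite -mulmxA (mulmxA (_ *t _)) tensmx_mul BA mulmx1 tensmx11 mul1mx.
  by rewrite mulVmx // posdef_unit.
exact/posdef_inv/data_cov_posdef.
Qed.

Lemma estimate_cov_lead n A C (P : 'M[K]_(n.+1 * m)) :
    posdefmx C -> posdefmx P ->
  psdmx (leadmx (estimate_cov A C P) - estimate_cov A C (leadmx P)).
Proof.
move=> Cpd Ppd; have Rpd := data_cov_posdef A Cpd Ppd.
have lPpd : posdefmx (leadmx P).
  by apply: posdef_mxsub => // i j [] /val_inj.
have lRpd := data_cov_posdef A Cpd lPpd.
rewrite [leadmx (estimate_cov _ _ _)]leadmxE !estimate_covE //.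
rewrite data_cov_lead in lRpd *.
set R := data_cov A C P in Rpd lRpd *; set E := extmx n L in lRpd *.
(* [X] is the cross-covariance of all [n.+1] data snapshots with the first [n] signals. The two
   terms are [X^H R^-1 X] and [X^H E (E^H R E)^-1 E^H X]. *)
set X := (1%:M *t A *m P) *m extmx n m.
have XE : 1%:M *t A *m leadmx P = E ^t* *m X.
  by rewrite /X leadmxE !mulmxA tens1_extmx_ct.
rewrite XE; have := psd_congr X (compressed_inv_le Rpd lRpd).
by rewrite mulmxBr mulmxBl /X !trmxC_mul trmxCK !mulmxA.
Qed.

Lemma btr_lead n (M : 'M[K]_(n.+1 * m)) :
  btr M = btr (leadmx M) + mxblk M ord_max ord_max.
Proof.
rewrite /btr big_ord_recr; congr (_ + _); apply: eq_bigr => t _.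
by apply/matrixP => i j; rewrite !mxE; congr (M _ _); apply: val_inj.
Qed.

Lemma btrB k (M N : 'M[K]_(k * m)) : btr (M - N) = btr M - btr N.
Proof.
rewrite /btr -sumrB; apply: eq_bigr => t _.
by apply/matrixP => i j; rewrite !mxE.
Qed.

Lemma psd_btr k (M : 'M[K]_(k * m)) : psdmx M -> psdmx (btr M).
Proof. by move=> Mpsd; apply: psd_sum => t; apply: psd_mxsub. Qed.

(* With one more snapshot, the estimates of the first [n] signals improve
   and the block of the last one adds a positive definite term. *)
Lemma btr_estimate_cov_lt n A C (P : 'M[K]_(n.+1 * m)) :
    row_free A^T -> posdefmx C -> posdefmx P ->
  posdef_lt (btr (estimate_cov A C (leadmx P))) (btr (estimate_cov A C P)).
Proof.
move=> Afree Cpd Ppd; rewrite /posdef_lt btr_lead addrAC -btrB.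
apply: posdefDr; first exact/psd_btr/estimate_cov_lead.
apply: posdef_mxsub; last exact: estimate_cov_posdef.
by move=> i j /(can_inj (@mxtens_indexK _ _)) [].
Qed.

End Snapshots.

(** * The factor [H] as a Gram matrix, and comparison of the bounds *)

Section Bound.
Variables (K : numClosedFieldType) (L m : nat).
Implicit Types (A D : 'M[K]_(L, m)) (C : 'M[K]_L).

Lemma gram_unit p q (G : 'M[K]_(p, q)) : row_free G^T ->
  G ^t* *m G \in unitmx.
Proof.
move=> /row_freeP[B GB]; apply: posdef_unit; rewrite -[G ^t*]mulmx1.
apply: (posdef_congr (Y := B^T)); last exact: posdef1.
by rewrite -[G]trmxK -trmx_mul GB trmx1.
Qed.

Lemma proj_orth_gram A C :
    row_free A^T -> posdefmx C ->
  proj_orth A C ^t* *m proj_orth A C = proj_orth A C.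
Proof.
move=> Afree Cpd; have [Wpd _] := invsqrtmxP Cpd.
have Wu := posdef_unit Wpd; rewrite /proj_orth.
(* [invsqrtmx C] is invertible, so [G] keeps the full column rank of [A]; the rest holds for any
   such [G]. *)
have : (invsqrtmx C *m A) ^t* *m (invsqrtmx C *m A) \in unitmx.
  apply: gram_unit; rewrite /row_free trmx_mul mxrankMfree //.
  by rewrite row_free_unit unitmx_tr.
move: (invsqrtmx C *m A) => G Gu; set Q := _ *m G ^t*.
have Qh : Q ^t* = Q.
  by rewrite !trmxC_mul trmxCK trmxC_inv trmxC_mul trmxCK mulmxA.
have QQ : Q *m Q = Q.
  by rewrite /Q -!mulmxA (mulmxA (G ^t*) G) mulKVmx // !mulmxA.
by rewrite trmxCB trmxC1 Qh mulmxBl mul1mx mulmxBr mulmx1 QQ subrr subr0.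
Qed.

(** Twice the real part is [Z^H Z] plus its conjugate, which is the Gram matrix of [Z] stacked on
    its conjugate. *)
Lemma re_gramE p q (Z : 'M[K]_(p, q)) :
  map_mx (fun z => 'Re z) (Z ^t* *m Z) =
  2^-1 *: ((col_mx Z (map_mx Num.conj Z)) ^t* *m col_mx Z (map_mx Num.conj Z)).
Proof.
rewrite tr_col_mx map_row_mx mul_row_col.
have -> : (map_mx Num.conj Z) ^t* *m map_mx Num.conj Z =
    map_mx Num.conj (Z ^t* *m Z) by rewrite map_mxM map_trmx.
by apply/matrixP => i j; rewrite !mxE /= ReE mulrC.
Qed.

(** The projection is Hermitian and idempotent, so it can be split between the two factors, giving
    [Z^H Z] inside the real part. *)
Lemma Hmx_gram A D C : row_free A^T -> posdefmx C ->
  exists S : 'M[K]_(L + L, m), Hmx A D C = 2^-1 *: (S ^t* *m S).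
Proof.
move=> Afree Cpd; have [[/hermsymmxP Wh _] _] := invsqrtmxP Cpd.
pose Z := proj_orth A C *m invsqrtmx C *m D.
exists (col_mx Z (map_mx Num.conj Z)); rewrite -re_gramE /Hmx.
rewrite /Z !trmxC_mul Wh -!mulmxA (mulmxA (_ ^t*)) -?mulmxA.
by rewrite (mulmxA (proj_orth A C ^t*)) proj_orth_gram.
Qed.

(* A zero column of [S] would be a zero column of the Hadamard product. *)
Lemma hadamard_unit_col p n (S : 'M[K]_(p, n)) (c : K) (Y : 'M[K]_n) :
    hadamardmx (c *: (S ^t* *m S)) Y \in unitmx -> forall j, col j S != 0.
Proof.
move=> Fu j; apply/eqP => Sj.
have F0 : hadamardmx (c *: (S ^t* *m S)) Y *m delta_mx j 0 = 0 :> 'cV_n.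
  rewrite -colE; apply/colP => i; rewrite !mxE big1 ?mulr0 ?mul0r // => k _.
  by have /colP/(_ k) := Sj; rewrite !mxE => ->; rewrite mulr0.
have /matrixP/(_ j 0)/eqP : (delta_mx j 0 : 'cV[K]_n) = 0.
  by rewrite -[LHS](mulKmx Fu) F0 mulmx0.
by rewrite !mxE !eqxx oner_eq0.
Qed.

Lemma hadamardZl n (c : K) (X Y : 'M[K]_n) :
  hadamardmx (c *: X) Y = c *: hadamardmx X Y.
Proof. by apply/matrixP => i j; rewrite !mxE mulrA. Qed.

Lemma hadamardBr n (X Y Z : 'M[K]_n) :
  hadamardmx X (Y - Z) = hadamardmx X Y - hadamardmx X Z.
Proof. by apply/matrixP => i j; rewrite !mxE mulrBr. Qed.

Lemma crb_lt n A D C (P : 'M[K]_(n.+1 * m)) :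
    (0 < n)%N -> row_free A^T -> posdefmx C -> posdefmx P ->
    fisher_core A D C P \in unitmx ->
  posdef_lt (crb A D C P) (crb A D C (leadmx P)).
Proof.
move=> n0 Afree Cpd Ppd.
have lPpd : posdefmx (leadmx P).
  by apply: posdef_mxsub => // i j [] /val_inj.
have half0 : 0 < 2^-1 :> K by rewrite invr_gt0.
have [S HS] := Hmx_gram D Afree Cpd.
have FE k (M : 'M[K]_(k * m)) : fisher_core A D C M =
    2^-1 *: hadamardmx (S ^t* *m S) (btr (estimate_cov A C M))^T.
  by rewrite -hadamardZl -HS.
(* [S] is the same for [n] and [n.+1] snapshots, so its nonzero columns serve both Schur products
   below. *)
rewrite {1}FE -hadamardZl => /hadamard_unit_col S0.
rewrite /posdef_lt /crb -scalerBr; apply: posdef_scale => //.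
apply: posdef_lt_inv; rewrite /posdef_lt !FE.
  (* First goal: the Fisher matrix for [n] snapshots is positive definite; [0 < n] provides a block
     for the trace. *)
  apply/posdef_scale/posdef_hadamard_gram/posdef_tr => //.
  by apply: posdef_btr => //; apply: estimate_cov_posdef.
(* Second goal: by linearity the Fisher increment is the Schur product with the increment of the
   block trace. *)
rewrite -scalerBr -hadamardBr -linearB.
apply/posdef_scale/posdef_hadamard_gram/posdef_tr => //.
exact: btr_estimate_cov_lt.
Qed.

End Bound.

Theorem theorem3 (R : realType) (L m n : nat)
    (L_gt0 : (0 < L)%N) (m_gt0 : (0 < m)%N) (n_gt0 : (0 < n)%N)
    (ltmL : (m < L)%N)
    (Theta : set R) (Theta_open : open Theta)
    (a : R -> 'cV[R[i]]_L) (a_smooth : smooth_on Theta a)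
    (a_unambiguous : forall th : 'I_L -> R, injective th ->
       (forall l, Theta (th l)) -> row_free (steering_mx a th)^T)
    (theta : 'I_m -> R) (theta_inj : injective theta)
    (theta_in : forall i, Theta (theta i))
    (A D : 'M[R[i]]_(L, m))
    (A_def : A = steering_mx a theta) (A_free : row_free A^T)
    (D_def : D = dsteering_mx a theta)
    (C : 'M[R[i]]_L) (C_pos : posdefmx C)
    (P : 'M[R[i]]_(n.+1 * m)) (P_pos : posdefmx P)
    (crbn_def : fisher_core A D C (leadmx P) \in unitmx)
    (crbSn_def : fisher_core A D C P \in unitmx) :
  posdef_lt (crb A D C P) (crb A D C (leadmx P)).
Proof. exact: crb_lt. Qed.
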